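(* For $i=1,\ldots,m$ let $G_i(x,\lambda)=G_{i0}(x)+\sum_{k=1}^r\lambda_kG_{ik}(x)$ be a symmetric $q_i\times q_i$ polynomial matrix, affine in $\lambda=(\lambda_1,\ldots,\lambda_r)$, with $x=(x_1,\ldots,x_n)$. Suppose that $1$ is an order unit for the cone $\mathcal Q_x(G)$ in $\mathcal V_r$. If a scalar polynomial $f\in\mathcal V_r$ is strictly positive on $K_G=\{(x,\lambda)\in\mathbb R^n\times\mathbb R^r: G_i(x,\lambda)\succeq 0,\ i=1,\ldots,m\}$, then $$f=\sigma_0+\sum_{i=1}^m\langle S_i(x),G_i(x,\lambda)\rangle$$ for some $\sigma_0\in\Sigma[x]$ and $S_i\in\Sigma^{q_i}[x]$. Moreover, the condition that $1$ is an order unit for $\mathcal Q_x(G)$ in $\mathcal V_r$ is equivalent to the existence of real numbers $R,C_1,\ldots,C_r>0$ with $R-\|x\|^2\in\mathcal Q_x(G)$ and $C_k+\lambda_k,\ C_k-\lambda_k\in\mathcal Q_x(G)$ for all $k=1,\ldots,r$.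
   Context: $\mathcal V_r=\{p_0(x)+\sum_{k=1}^r\lambda_k p_k(x): p_0,\ldots,p_r\in\mathbb R[x]\}$ is the real vector space of polynomials affine in $\lambda$. $\Sigma[x]$ is the cone of finite sums of squares in $\mathbb R[x]$. $\Sigma^q[x]$ is the cone of SOS polynomial matrices of size $q$: $S\in\Sigma^q[x]$ if $S=P^{\intercal}P$ for some polynomial matrix $P$ in $x$ with $q$ columns (and finitely many rows). $\langle A,B\rangle=\operatorname{tr}(AB)$ for symmetric matrices. $\mathcal Q_x(G)=\{\sigma_0+\sum_{i=1}^m\langle S_i,G_i\rangle:\sigma_0\in\Sigma[x],\ S_i\in\Sigma^{q_i}[x]\}\subseteq\mathcal V_r$. An element $e$ of a convex cone $C$ in a real vector space $V$ is an order unit for $C$ in $V$ if for every $v\in V$ there is $N>0$ with $Ne+v,\ Ne-v\in C$. *)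

(* Defs.v *)
From mathcomp Require Import all_boot all_order all_algebra.
From mathcomp Require Import mpoly reals.

Set Implicit Arguments.
Unset Strict Implicit.
Unset Printing Implicit Defensive.

Import Order.TTheory GRing.Theory Num.Theory.
Local Open Scope ring_scope.

(* Polynomials in (x, lambda) live in {mpoly R[n + r]}: the first n variables
   are x_1, ..., x_n and the last r variables are lambda_1, ..., lambda_r.
   Polynomials in x alone live in {mpoly R[n]}. *)

Section Pencils.

Variables (R : realType) (n r : nat).

Definition of_x (p : {mpoly R[n]}) : {mpoly R[n + r]} :=
  p \mPo [tuple 'X_(lshift r j) | j < n].

Definition lambda (k : 'I_r) : {mpoly R[n + r]} := 'X_(rshift n k).

Definition point (x : 'I_n -> R) (lam : 'I_r -> R) (i : 'I_(n + r)) : R :=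
  match split i with inl j => x j | inr k => lam k end.

(* The real vector space V_r, as a subspace of {mpoly R[n + r]}. *)
Definition affine_in_lambda (f : {mpoly R[n + r]}) : Prop :=
  exists (p0 : {mpoly R[n]}) (p : 'I_r -> {mpoly R[n]}),
    f = of_x p0 + \sum_(k < r) lambda k * of_x (p k).

Definition pencil (q : nat) (A0 : 'M[{mpoly R[n]}]_q)
    (A : 'I_r -> 'M[{mpoly R[n]}]_q) : 'M[{mpoly R[n + r]}]_q :=
  map_mx of_x A0 + \sum_(k < r) lambda k *: map_mx of_x (A k).

Definition sos (s : {mpoly R[n]}) : Prop :=
  exists t : seq {mpoly R[n]}, s = \sum_(p <- t) p ^+ 2.

Definition sos_mx (q : nat) (S : 'M[{mpoly R[n]}]_q) : Prop :=
  exists (l : nat) (P : 'M[{mpoly R[n]}]_(l, q)), S = P^T *m P.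

Definition psd (q : nat) (M : 'M[R]_q) : Prop :=
  M^T = M /\ forall v : 'cV[R]_q, 0 <= (v^T *m M *m v) 0 0.

Variables (m : nat) (q : 'I_m -> nat).
Variable G : forall i : 'I_m, 'M[{mpoly R[n + r]}]_(q i).

Definition in_K (x : 'I_n -> R) (lam : 'I_r -> R) : Prop :=
  forall i : 'I_m, psd (map_mx (meval (point x lam)) (G i)).

Definition Qx (f : {mpoly R[n + r]}) : Prop :=
  exists (s0 : {mpoly R[n]}) (S : forall i : 'I_m, 'M[{mpoly R[n]}]_(q i)),
    [/\ sos s0, forall i, sos_mx (S i)
      & f = of_x s0 + \sum_(i < m) \tr (map_mx of_x (S i) *m G i)].

End Pencils.

Arguments lambda {R} n {r} k.

(* The ambient real vector space of the cone [C] is the subspace [V] of [E]. *)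
Definition order_unit (R : realType) (E : lmodType R) (V C : E -> Prop)
    (e : E) : Prop :=
  C e /\
  forall v : E, V v -> exists N : R, [/\ 0 < N, C (N *: e + v) & C (N *: e - v)].

(* Main.v *)
From HB Require Import structures.
From mathcomp Require Import all_boot all_order all_algebra.
From mathcomp Require Import boolp classical_sets mpoly reals ring lra.
Require Import Defs.

Set Implicit Arguments.
Unset Strict Implicit.
Unset Printing Implicit Defensive.

Import Order.TTheory GRing.Theory Num.Theory.
Local Open Scope ring_scope.

(** If [f] is not in the cone [Q], then [- 1] is not in [Q - Sigma f], and Zorn's
    lemma yields a maximal [Sigma]-module [M] of polynomials containing [Q] and
    [- f] but not [- 1].  Maximality makes [M] total on V_r, and since [1] is an
    order unit every [v] in V_r differs from a unique real number by an
    infinitesimal.  Infinitesimals form an R[x]-submodule, so this real part is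
    the evaluation at a point [(x, lambda)]; testing against [<v v^T, G_i>] puts
    that point in K_G, while [- f] in [M] forces [f (x, lambda) <= 0].  For the
    equivalence, the polynomials [p] in [x] with [N - p^2] in [Q] for some [N]
    form a ring, which contains the variables as soon as [R - |x|^2] is in [Q]. *)

(** * Cones stable under multiplication by squares of a coefficient ring *)

Section QuadraticModules.

Variables (R : realType) (A E : comNzRingType).
Variables (cst : {rmorphism R -> A}) (phi : {rmorphism A -> E}).

Local Notation "c %:K" := (phi (cst c)) (at level 2, format "c %:K").

Definition sum_of_squares (s : A) : Prop :=
  exists t : seq A, s = \sum_(p <- t) p ^+ 2.

Lemma sum_of_squares0 : sum_of_squares 0.
Proof. by exists [::]; rewrite big_nil. Qed.

Lemma sum_of_squares1 : sum_of_squares 1.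
Proof. by exists [:: 1]; rewrite big_seq1 expr1n. Qed.

Lemma sum_of_squaresD s t :
  sum_of_squares s -> sum_of_squares t -> sum_of_squares (s + t).
Proof. by move=> [a ->] [b ->]; exists (a ++ b); rewrite big_cat. Qed.

Lemma sum_of_squares_sqrM p s :
  sum_of_squares s -> sum_of_squares (p ^+ 2 * s).
Proof.
move=> [a ->]; exists [seq p * x | x <- a].
by rewrite big_map mulr_sumr; apply: eq_bigr => x _; rewrite exprMn.
Qed.

(** The identity is [p = ((p + 1) / 2)^2 - ((p - 1) / 2)^2]. It extends closure properties from
    square multipliers to arbitrary multipliers in [A]. *)
Lemma mulr_sub_sqr p v :
  exists s t, phi p * v = phi s ^+ 2 * v + - (phi t ^+ 2 * v).
Proof.
pose h := cst 2^-1; exists (p * h + h), (p * h - h).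
have hh : h + h = 1 by rewrite -rmorphD -(rmorph1 cst); congr (cst _); field.
transitivity (phi p * phi (h + h) ^+ 2 * v); last by ring.
by rewrite hh rmorph1 expr1n mulr1.
Qed.

(** Multipliers are squares from [A] only: with [A] the polynomials in [x] and [E] those in
    [(x, lambda)], squares involving [lambda] need not lie in [Q]. *)
Definition quadratic_module (Q : E -> Prop) : Prop :=
  [/\ Q 1, forall u v, Q u -> Q v -> Q (u + v)
    & forall p v, Q v -> Q (phi p ^+ 2 * v)].

Definition bounded (Q : E -> Prop) (v : E) : Prop :=
  exists N : R, [/\ 0 < N, Q (N%:K + v) & Q (N%:K - v)].

Definition archimedean_on (V Q : E -> Prop) : Prop :=
  forall v, V v -> bounded Q v.

Definition adjoin (Q : E -> Prop) (a v : E) : Prop :=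
  exists u s, [/\ Q u, sum_of_squares s & v = u + phi s * a].

Definition infinitesimal (Q : E -> Prop) (v : E) : Prop :=
  forall e : R, 0 < e -> Q (e%:K + v) /\ Q (e%:K - v).

Definition square_bounded (Q : E -> Prop) (p : A) : Prop :=
  exists N : R, 0 < N /\ Q (N%:K - phi p ^+ 2).

Section Closure.

Variables (Q : E -> Prop) (qmQ : quadratic_module Q).

Lemma qm1 : Q 1. Proof. by case: qmQ. Qed.

Lemma qmD u v : Q u -> Q v -> Q (u + v).
Proof. by case: qmQ => _ h _; apply: h. Qed.

Lemma qm_sqrM p v : Q v -> Q (phi p ^+ 2 * v).
Proof. by case: qmQ => _ _; apply. Qed.

Lemma qm0 : Q 0.
Proof. by have := qm_sqrM 0 qm1; rewrite rmorph0 expr0n mul0r. Qed.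

Lemma qm_sqr p : Q (phi p ^+ 2).
Proof. by rewrite -[_ ^+ 2]mulr1; apply/qm_sqrM/qm1. Qed.

Lemma qm_sosM s v : sum_of_squares s -> Q v -> Q (phi s * v).
Proof.
move=> [t ->] Qv; rewrite rmorph_sum mulr_suml.
apply: (big_ind Q) => [||p _]; [exact: qm0|exact: qmD|].
by rewrite rmorphXn; apply: qm_sqrM.
Qed.

Lemma qm_cstM (c : R) v : 0 <= c -> Q v -> Q (c%:K * v).
Proof. by move=> c0; rewrite -{1}(sqr_sqrtr c0) !rmorphXn; apply: qm_sqrM. Qed.

Lemma qm_cst (c : R) : 0 <= c -> Q c%:K.
Proof. by move=> c0; rewrite -[_%:K]mulr1; apply: qm_cstM => //; exact: qm1. Qed.

Lemma qm_cst_le (c d : R) v : c <= d -> Q (c%:K + v) -> Q (d%:K + v).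
Proof.
rewrite -subr_ge0 => /qm_cst h Qv.
have -> : d%:K + v = (d - c)%:K + (c%:K + v) by rewrite !rmorphB; ring.
exact: qmD.
Qed.

Lemma qm_adjoin a : quadratic_module (adjoin Q a).
Proof.
split.
- exists 1, 0; split; [exact: qm1|exact: sum_of_squares0|].
  by rewrite rmorph0 mul0r addr0.
- move=> _ _ [u [s [Qu hs ->]]] [v [t [Qv ht ->]]]; exists (u + v), (s + t).
  by split; [exact: qmD|exact: sum_of_squaresD|rewrite rmorphD; ring].
- move=> p _ [u [s [Qu hs ->]]]; exists (phi p ^+ 2 * u), (p ^+ 2 * s).
  split; [exact: qm_sqrM|exact: sum_of_squares_sqrM|].
  by rewrite rmorphM rmorphXn; ring.
Qed.

Lemma adjoin_sub a v : Q v -> adjoin Q a v.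
Proof.
move=> Qv; exists v, 0; split; [by []|exact: sum_of_squares0|].
by rewrite rmorph0 mul0r addr0.
Qed.

Lemma adjoin_mem a : adjoin Q a a.
Proof.
exists 0, 1; split; [exact: qm0|exact: sum_of_squares1|].
by rewrite rmorph1 mul1r add0r.
Qed.

Lemma proper_cst (c : R) : ~ Q (- 1) -> Q c%:K -> 0 <= c.
Proof.
move=> ne1 Qc; rewrite leNgt; apply/negP => c0; apply: ne1.
have h : 0 <= (- c)^-1 by rewrite invr_ge0 oppr_ge0 ltW.
have := qm_cstM h Qc; rewrite -!rmorphM invrN mulNr mulVf ?lt_eqF//.
by rewrite !rmorphN !rmorph1.
Qed.

(** * Archimedean modules, infinitesimals and real parts *)

Section Archimedean.

Variable V : E -> Prop.
Hypotheses (V1 : V 1) (VM : forall p v, V v -> V (phi p * v)).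
Hypothesis archQ : archimedean_on V Q.

(* Multiplying [sf - 1] by a large constant shows that [f + r] in [Q] implies
   [f + (r - N^-2)] in [Q], for [N] independent of [r >= 0]. *)
Lemma qm_of_sos_multiple f s :
  V f -> sum_of_squares s -> Q (phi s * f - 1) -> Q f.
Proof.
move=> Vf hs Qsf.
have [N1 [N1_gt0 _ hN1]] := archQ (VM s V1).
have [N2 [N2_gt0 _ hN2]] := archQ (VM (s ^+ 2) Vf).
(* Chosen so that [2 N >= N1] and [2 N - 1 >= N2]. *)
pose N := N1 + N2 + 1.
have N0 : 0 < N by rewrite /N; lra.
have QN1 : Q ((2 * N)%:K - phi s).
  by rewrite mulr1 in hN1; apply: qm_cst_le hN1; rewrite /N; lra.
have QN2 : Q ((2 * N - 1)%:K - phi s ^+ 2 * f).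
  by rewrite rmorphXn in hN2; apply: qm_cst_le hN2; rewrite /N; lra.
pose e := N^-1 ^+ 2.
have e0 : 0 < e by rewrite exprn_gt0 ?invr_gt0.
have step r : 0 <= r -> Q (f + r%:K) -> Q (f + (r - e)%:K).
  move=> r0 Qfr.
  (* Inside the outer parentheses everything cancels except [N^2 (f + r) - 1], while each summand is
     visibly in [Q]. *)
  have -> : f + (r - e)%:K = (N^-1)%:K ^+ 2 *
    (phi (cst N - s) ^+ 2 * (f + r%:K) + (2 * N)%:K * (phi s * f - 1)
     + r%:K * (phi s * ((2 * N)%:K - phi s))
     + ((2 * N - 1)%:K - phi s ^+ 2 * f)).
    have NV : N%:K * (N^-1)%:K = 1 by rewrite -!rmorphM mulfV ?gt_eqF// !rmorph1.
    rewrite /e; move: (N^-1) NV => M NV; apply/eqP; rewrite -subr_eq0; apply/eqP.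
    transitivity ((1 - (N%:K * M%:K) ^+ 2) * (f + r%:K)); last first.
      by rewrite NV; ring.
    by ring.
  apply: qm_sqrM; apply: qmD QN2; apply: qmD; first apply: qmD.
  - exact: qm_sqrM.
  - by apply: qm_cstM => //; lra.
  - by apply: qm_cstM => //; apply: qm_sosM.
have iter k r : r <= k%:R * e -> Q (f + r%:K) -> Q f.
  elim: k r => [|k IH] r.
    rewrite mul0r => r0 Qfr.
    have -> : f = (- r)%:K + (f + r%:K) by rewrite !rmorphN; ring.
    by apply: qmD => //; apply: qm_cst; rewrite oppr_ge0.
  have [r0 rk /step|r0 _ Qfr] := leP 0 r.
    by move/(_ r0); apply: IH; rewrite mulrS in rk; lra.
  by apply: (IH r) => //; apply: le_trans (ltW r0) _; rewrite mulr_ge0// ltW.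
have [r [r0 hr _]] := archQ Vf.
rewrite addrC in hr; apply: (iter (Num.bound (r / e))) hr.
rewrite -ler_pdivrMr//; apply: ltW; apply: archi_boundP.
by rewrite divr_ge0// ltW.
Qed.

Lemma infinitesimalD u v :
  infinitesimal Q u -> infinitesimal Q v -> infinitesimal Q (u + v).
Proof.
move=> iu iv e e0; have e2 : 0 < e / 2 by lra.
have ee : e%:K = (e / 2)%:K + (e / 2)%:K by rewrite -!rmorphD; congr _%:K; field.
have [[u1 u2] [v1 v2]] := (iu _ e2, iv _ e2).
by split; [have := qmD u1 v1|have := qmD u2 v2]; rewrite ee;
  [rewrite addrACA|rewrite addrACA -opprD].
Qed.

Lemma infinitesimal0 : infinitesimal Q 0.
Proof. by move=> e e0; rewrite subr0 addr0; split; apply/qm_cst/ltW. Qed.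

Lemma infinitesimalN v : infinitesimal Q v -> infinitesimal Q (- v).
Proof. by move=> iv e /iv[h1 h2]; rewrite opprK. Qed.

(** For a square multiplier bounded by [N], write [e + t^2 v = (e / N) (N - t^2) + t^2 (e / N + v)],
    and likewise for [- v]. The general case is a difference of two squares. *)
Lemma infinitesimalM p v : infinitesimal Q v -> infinitesimal Q (phi p * v).
Proof.
move=> iv.
have sqrM t : infinitesimal Q (phi t ^+ 2 * v).
  move=> e e0; have [N [N0 _]] := archQ (VM (t ^+ 2) V1).
  rewrite mulr1 rmorphXn => hN.
  have eN : 0 < e / N by rewrite divr_gt0.
  have ee : e%:K = (e / N)%:K * N%:K by rewrite -!rmorphM divfK// gt_eqF.
  have [v1 v2] := iv _ eN.
  have hN' := qm_cstM (ltW eN) hN.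
  split; [have := qmD hN' (qm_sqrM t v1)|have := qmD hN' (qm_sqrM t v2)];
    congr Q; rewrite ee; ring.
have [s [t ->]] := mulr_sub_sqr p v.
by apply: infinitesimalD => //; apply: infinitesimalN.
Qed.

Lemma infinitesimal_cst (c : R) v :
  ~ Q (- 1) -> infinitesimal Q (v - c%:K) -> Q v -> 0 <= c.
Proof.
move=> ne1 iv Qv; rewrite leNgt; apply/negP => c0.
pose d := c / 2; have cE : c = d + d by rewrite /d; field.
(* Adding [v] to [- d - (v - c)] leaves [c - d = d], a negative constant, in [Q]. *)
have [_ h] := iv (- d) ltac:(lra).
suff: 0 <= d by lra.
by apply: (proper_cst ne1); have := qmD h Qv; congr Q; rewrite cE; ring.
Qed.

Section RealPart.

Hypotheses (ne1 : ~ Q (- 1)) (total : forall v, V v -> Q v \/ Q (- v)).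
Hypothesis VD : forall u v, V u -> V v -> V (u + v).

(** The real part is the supremum of the constants [c] with [v - c] in [Q]; the order unit makes
    this set nonempty and bounded above. *)
Lemma real_part v : V v -> exists c : R, infinitesimal Q (v - c%:K).
Proof.
move=> Vv; pose S := [set c : R | Q (v - c%:K)]%classic.
have [N [N0 hN1 hN2]] := archQ Vv.
have supS : has_sup S.
  split.
    by exists (- N); rewrite /S /=; move: hN1; congr Q; rewrite !rmorphN; ring.
  exists N => c Sc; rewrite -subr_ge0; apply: (proper_cst ne1).
  by have := qmD hN2 Sc; congr Q; rewrite !rmorphB; ring.
exists (sup S) => e e0; split.
  have [c Sc ltc] := sup_adherent e0 supS.
  have c0 : 0 <= e + c - sup S by lra.
  by have := qmD (qm_cst c0) Sc; congr Q; rewrite !(rmorphB, rmorphD); ring.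
(* [v - (sup S + e)] cannot lie in [Q], as [sup S + e] would then belong to [S]; totality puts its
   opposite in [Q]. *)
have Vw : V (v - (sup S + e)%:K).
  apply: VD => //; rewrite -!rmorphN -[_%:K]mulr1; exact: VM.
have [h|] := total Vw; last by congr Q; rewrite !rmorphD; ring.
have := ub_le_sup (proj2 supS) h; lra.
Qed.

End RealPart.

End Archimedean.

(** * Bounded elements *)

Lemma square_bounded_cst c : square_bounded Q (cst c).
Proof.
exists (c ^+ 2 + 1); split; first by have := sqr_ge0 c; lra.
by rewrite -!rmorphXn -!rmorphB addrC addKr; apply: qm_cst; lra.
Qed.

Lemma square_boundedD p s :
  square_bounded Q p -> square_bounded Q s -> square_bounded Q (p + s).
Proof.
move=> [N [N0 hN]] [M [M0 hM]]; exists (2 * N + 2 * M); split; first lra.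
(* Parallelogram identity. *)
have -> : (2 * N + 2 * M)%:K - phi (p + s) ^+ 2 =
    2%:K * (N%:K - phi p ^+ 2) + 2%:K * (M%:K - phi s ^+ 2)
    + phi (p - s) ^+ 2 by ring.
by apply: qmD (qm_sqr _); apply: qmD; apply: qm_cstM.
Qed.

Lemma square_boundedM p s :
  square_bounded Q p -> square_bounded Q s -> square_bounded Q (p * s).
Proof.
move=> [N [N0 hN]] [M [M0 hM]]; exists (N * M); split; first exact: mulr_gt0.
have -> : (N * M)%:K - phi (p * s) ^+ 2 =
    phi s ^+ 2 * (N%:K - phi p ^+ 2) + N%:K * (M%:K - phi s ^+ 2) by ring.
by apply: qmD; [apply: qm_sqrM|apply: qm_cstM => //; apply: ltW].
Qed.

Lemma boundedD u v : bounded Q u -> bounded Q v -> bounded Q (u + v).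
Proof.
move=> [N [N0 h1 h2]] [M [M0 h3 h4]]; exists (N + M); split.
- exact: addr_gt0.
- by have := qmD h1 h3; congr Q; ring.
- by have := qmD h2 h4; congr Q; ring.
Qed.

Lemma boundedN u : bounded Q u -> bounded Q (- u).
Proof. by move=> [N [N0 h1 h2]]; exists N; rewrite opprK. Qed.

Lemma bounded1 : bounded Q 1.
Proof.
exists 1; split => //; first by apply: qmD; [apply: qm_cst|apply: qm1].
by rewrite !rmorph1 subrr; exact: qm0.
Qed.

(** For squares, [N M + s^2 v = N (M - s^2) + s^2 (N + v)], and likewise for [- v]; then split [p]
    as a difference of squares. *)
Lemma boundedM p v : (forall s, square_bounded Q s) -> bounded Q v ->
  bounded Q (phi p * v).
Proof.
move=> bA [N [N0 h1 h2]].
have sqrM s : bounded Q (phi s ^+ 2 * v).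
  have [M [M0 hM]] := bA s; exists (N * M); split; first exact: mulr_gt0.
  - by have := qmD (qm_cstM (ltW N0) hM) (qm_sqrM s h1); congr Q; ring.
  - by have := qmD (qm_cstM (ltW N0) hM) (qm_sqrM s h2); congr Q; ring.
have [s [t ->]] := mulr_sub_sqr p v.
by apply: boundedD => //; apply: boundedN.
Qed.

End Closure.

(** * Maximal proper modules and separation *)

Lemma exists_maximal Q : quadratic_module Q -> ~ Q (- 1) ->
  exists M : E -> Prop,
    [/\ quadratic_module M, forall v, Q v -> M v, ~ M (- 1)
      & forall M' : E -> Prop, quadratic_module M' ->
          (forall v, M v -> M' v) -> ~ M' (- 1) -> forall v, M' v -> M v].
Proof.
move=> qmQ ne1.
pose good (M : set E) :=
  [/\ quadratic_module M, forall v, Q v -> M v & ~ M (- 1)].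
have [F Fgood Ftot|M [[M0|[qmM QM neM]] maxM]] :=
    @Zorn_bigcup E (fun M => M = set0 \/ good M).
- have [[X0 FX0 [x0 X0x0]]|F0] :=
      pselect (exists2 X, F X & exists x, X x); last first.
    left; apply/seteqP; split => // x [X FX Xx]; apply: F0.
    by exists X => //; exists x.
  have nonempty X x : F X -> X x -> good X.
    by move=> FX Xx; case: (Fgood X FX) => // XE; rewrite XE in Xx.
  have [[X01 _ _] QX0 _] := nonempty _ _ FX0 X0x0.
  right; split; first split.
  + by exists X0.
  + move=> u v [X FX Xu] [Y FY Yv].
    have [[_ XD _] _ _] := nonempty _ _ FX Xu.
    have [[_ YD _] _ _] := nonempty _ _ FY Yv.
    have [XY|YX] := Ftot X Y FX FY.
    * by exists Y => //; apply: YD => //; apply: XY.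
    * by exists X => //; apply: XD => //; apply: YX.
  + move=> p v [X FX Xv]; exists X => //.
    by have [[_ _ XM] _ _] := nonempty _ _ FX Xv; apply: XM.
  + by move=> v Qv; exists X0 => //; apply: QX0.
  + by move=> [X FX X1]; have [_ _] := nonempty _ _ FX X1; apply.
- case: (maxM Q); last by right; split.
  by split; rewrite M0 // => /(_ 1); apply; case: qmQ.
- exists M; split => // M' qmM' MM' neM' v M'v; apply: contrapT => nMv.
  apply: (maxM M'); last by right; split => // u /QM /MM'.
  by split => // /(_ v M'v).
Qed.

(* If neither [a] nor [- a] could be adjoined,
   there would be relations [- 1 = s1 + t1 a] and [- 1 = s2 - t2 a]; then
   [- t1] is in [M], hence so is [t1 a = t1 (N + a) - N t1], and thus [- 1]. *)
Lemma maximal_total (V M : E -> Prop) : quadratic_module M -> ~ M (- 1) ->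
  archimedean_on V M ->
  (forall M' : E -> Prop, quadratic_module M' ->
     (forall v, M v -> M' v) -> ~ M' (- 1) -> forall v, M' v -> M v) ->
  forall a, V a -> M a \/ M (- a).
Proof.
move=> qmM ne1 archM maxM a Va.
have adjoinP b : M b \/ adjoin M b (- 1).
  have [|nb] := pselect (adjoin M b (- 1)); first by right.
  left; apply: (maxM _ (qm_adjoin qmM b)) => //; last exact: adjoin_mem.
  exact: adjoin_sub.
have [|[s1 [t1 [Ms1 ht1 E1]]]] := adjoinP a; first by left.
have [|[s2 [t2 [Ms2 ht2 E2]]]] := adjoinP (- a); first by right.
exfalso; apply: ne1.
have mt1 : M (- phi t1).
  (* Adding [t2] times the first relation to [t1] times the second eliminates [a]. *)
  have -> : - phi t1 = phi t2 * 1 + phi t2 * s1 + phi t1 * s2.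
    have -> : s1 = - 1 - phi t1 * a by rewrite E1 addrK.
    have -> : s2 = - 1 + phi t2 * a by rewrite E2 mulrN subrK.
    ring.
  have M1 := qm1 qmM.
  by apply: (qmD qmM); [apply: (qmD qmM)|]; apply: qm_sosM.
have [N [N0 h _]] := archM a Va.
rewrite E1; apply: (qmD qmM Ms1).
have -> : phi t1 * a = phi t1 * (N%:K + a) + N%:K * (- phi t1) by ring.
by apply: (qmD qmM); [exact: qm_sosM|apply: qm_cstM => //; apply: ltW].
Qed.

Lemma separating_module (V Q : E -> Prop) f :
  V 1 -> (forall u v, V u -> V v -> V (u + v)) ->
  (forall p v, V v -> V (phi p * v)) ->
  quadratic_module Q -> archimedean_on V Q -> V f -> ~ Q f ->
  exists M : E -> Prop,
    [/\ quadratic_module M, forall v, Q v -> M v, M (- f), ~ M (- 1)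
      & forall v, V v -> exists c : R, infinitesimal M (v - c%:K)].
Proof.
move=> V1 VD VM qmQ archQ Vf nQf.
(* A relation [- 1 = u - s f] would put [s f - 1 = u] in [Q], and then [f] itself. *)
have ne1 : ~ adjoin Q (- f) (- 1).
  move=> [u [s [Qu hs E1]]]; apply: nQf.
  apply: (qm_of_sos_multiple qmQ V1 VM archQ Vf hs).
  have -> // : phi s * f - 1 = u by rewrite E1; ring.
have [M [qmM QM neM maxM]] := exists_maximal (qm_adjoin qmQ (- f)) ne1.
have QM' v : Q v -> M v by move=> Qv; apply/QM/adjoin_sub.
have archM : archimedean_on V M.
  by move=> v /archQ[N [N0 h1 h2]]; exists N; split => //; apply: QM'.
exists M; split => //; first exact/QM/adjoin_mem.
have tot := maximal_total qmM neM archM maxM.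
by move=> v; apply: (real_part qmM V1 VM archM neM tot VD).
Qed.

End QuadraticModules.

(** * Polynomials affine in [lambda] and their evaluation *)

Lemma mpoly_subring_ind (n : nat) (R : comNzRingType) (P : {mpoly R[n]} -> Prop) :
  (forall c, P c%:MP) -> (forall j, P 'X_j) ->
  (forall p q, P p -> P q -> P (p + q)) ->
  (forall p q, P p -> P q -> P (p * q)) -> forall p, P p.
Proof.
move=> PC PX PD PM p; rewrite (mpolyE p).
apply: big_ind => [||m _]; [by rewrite -mpolyC0|exact: PD|].
rewrite -mul_mpolyC; apply: (PM) => //; rewrite mpolyXE_id.
apply: big_ind => [||j _]; [by rewrite -mpolyC1|exact: (PM)|].
elim: (m j) => [|k IH]; first by rewrite expr0 -mpolyC1.
by rewrite exprS; apply: PM.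
Qed.

Section LinearPencils.

Variables (R : realType) (n r : nat).

Local Notation A := {mpoly R[n]}.
Local Notation E := {mpoly R[n + r]}.

HB.instance Definition _ := GRing.RMorphism.copy (@of_x R n r)
  (comp_mpoly [tuple ('X_(lshift r j) : E) | j < n]).

Local Notation V := (@affine_in_lambda R n r).

Lemma of_xC c : of_x r (c%:MP : A) = c%:MP.
Proof. exact: comp_mpolyC. Qed.

Lemma affine_of_x p : V (of_x r p).
Proof.
exists p, (fun=> 0); rewrite big1 ?addr0// => k _.
by rewrite rmorph0 mulr0.
Qed.

Lemma affine1 : V 1.
Proof. by rewrite -(rmorph1 (of_x r)); apply: affine_of_x. Qed.

Lemma affineD u v : V u -> V v -> V (u + v).
Proof.
move=> [p0 [p ->]] [s0 [s ->]]; exists (p0 + s0), (fun k => p k + s k).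
rewrite rmorphD addrACA -big_split; congr (_ + _).
by apply: eq_bigr => k _; rewrite rmorphD mulrDr.
Qed.

Lemma affineM p v : V v -> V (of_x r p * v).
Proof.
move=> [p0 [s ->]]; exists (p * p0), (fun k => p * s k).
rewrite rmorphM mulrDr; congr (_ + _).
by rewrite mulr_sumr; apply: eq_bigr => k _; rewrite rmorphM mulrCA.
Qed.

Lemma affine_lambda k : V (lambda n k).
Proof.
exists 0, (fun j => (j == k)%:R); rewrite rmorph0 add0r (bigD1 k)//= eqxx.
rewrite rmorph1 mulr1 big1 ?addr0// => j /negPf ->.
by rewrite rmorph0 mulr0.
Qed.

Lemma affine_mxtrace_pencil q (S A0 : 'M[A]_q) (A1 : 'I_r -> 'M[A]_q) :
  V (\tr (map_mx (of_x r) S *m pencil A0 A1)).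
Proof.
exists (\tr (S *m A0)), (fun k => \tr (S *m A1 k)).
rewrite mulmxDr mxtraceD -map_mxM trace_map_mx; congr (_ + _).
rewrite mulmx_sumr raddf_sum; apply: eq_bigr => k _.
by rewrite /= -scalemxAr mxtraceZ -map_mxM trace_map_mx.
Qed.

Lemma meval_of_x (x : 'I_n -> R) (lam : 'I_r -> R) (p : A) :
  (of_x r p).@[point x lam] = p.@[x].
Proof.
rewrite comp_mpoly_meval; apply: meval_eq => i.
by rewrite tnth_mktuple mevalXU /point (unsplitK (inl i)).
Qed.

Lemma meval_lambda (x : 'I_n -> R) (lam : 'I_r -> R) k :
  (lambda n k).@[point x lam] = lam k.
Proof. by rewrite mevalXU /point (unsplitK (inr k)). Qed.

Section EvaluationPoint.

Variables (M : E -> Prop) (x : 'I_n -> R) (lam : 'I_r -> R).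
Hypothesis qmM : quadratic_module (@of_x R n r) M.
Hypothesis archM : archimedean_on (@mpolyC n R) (@of_x R n r) V M.
Local Notation inf := (infinitesimal (@mpolyC n R) (@of_x R n r) M).
Hypothesis infx : forall j, inf (of_x r 'X_j - of_x r (x j)%:MP).
Hypothesis infl : forall k, inf (lambda n k - of_x r (lam k)%:MP).

(** The polynomials with this property form a subring, since [p s - p(x) s(x) = s (p - p(x)) + p(x)
    (s - s(x))]. *)
Lemma infinitesimal_meval_of_x p : inf (of_x r p - of_x r (p.@[x])%:MP).
Proof.
have VM := @affineM; have V1 := affine1.
pose iM := infinitesimalM qmM V1 VM archM.
have iD := @infinitesimalD _ _ _ (@mpolyC n R) _ _ qmM.
elim/mpoly_subring_ind: p => [c|j|p s ip iq|p s ip iq].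
- rewrite mevalC subrr; exact: (infinitesimal0 _ qmM).
- by rewrite mevalXU.
- have := iD _ _ ip iq; congr inf; rewrite mevalD; ring.
- have := iD _ _ (iM s _ ip) (iM (p.@[x])%:MP _ iq).
  by congr inf; rewrite mevalM; ring.
Qed.

(** Infinitesimals may be multiplied by polynomials in [x] only. This suffices for terms linear in
    [lambda]: [lambda_k p - lam_k p(x) = p (lambda_k - lam_k) + lam_k (p - p(x))]. *)
Lemma infinitesimal_meval v : V v -> inf (v - of_x r (v.@[point x lam])%:MP).
Proof.
have VM := @affineM; have V1 := affine1.
pose iM := infinitesimalM qmM V1 VM archM.
have iD := @infinitesimalD _ _ _ (@mpolyC n R) _ _ qmM.
move=> [p0 [p ->]].
have -> : (of_x r p0 + \sum_(k < r) lambda n k * of_x r (p k)).@[point x lam] =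
    p0.@[x] + \sum_(k < r) lam k * (p k).@[x].
  rewrite mevalD meval_of_x (rmorph_sum (meval (point x lam))); congr (_ + _).
  by apply: eq_bigr => k _ /=; rewrite mevalM meval_lambda meval_of_x.
suff: inf ((of_x r p0 - of_x r (p0.@[x])%:MP)
    + \sum_(k < r) (lambda n k * of_x r (p k)
                    - of_x r (lam k * (p k).@[x])%:MP)).
  by congr inf; rewrite sumrB !(rmorphD, rmorph_sum) /= opprD addrACA.
apply: (iD); first exact: infinitesimal_meval_of_x.
apply: big_ind => [||k _].
- exact: (infinitesimal0 _ qmM).
- exact: (iD).
- have := iD _ _ (iM (p k) _ (infl k))
    (iM (lam k)%:MP _ (infinitesimal_meval_of_x (p k))).
  by congr inf; ring.
Qed.

End EvaluationPoint.

(** * The cone of the pencils [G i] *)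

Section Cone.

Variables (m : nat) (q : 'I_m -> nat).
Variable G : forall i : 'I_m, 'M[E]_(q i).

Lemma quadratic_module_Qx : quadratic_module (@of_x R n r) (Qx G).
Proof.
split.
- exists 1, (fun=> 0); split.
  + exact: sum_of_squares1.
  + by move=> i; exists 0, 0; rewrite mulmx0.
  + rewrite rmorph1 big1 ?addr0// => i _.
    by rewrite map_mx0 mul0mx mxtrace0.
- move=> _ _ [s [S [hs hS ->]]] [t [T [ht hT ->]]].
  exists (s + t), (fun i => S i + T i); split.
  + exact: sum_of_squaresD.
  + move=> i; have [[k [P ->]] [l [L ->]]] := (hS i, hT i).
    by exists (k + l)%N, (col_mx P L); rewrite tr_col_mx mul_row_col.
  + rewrite rmorphD addrACA -big_split; congr (_ + _).
    by apply: eq_bigr => i _; rewrite map_mxD mulmxDl mxtraceD.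
- move=> p _ [s [S [hs hS ->]]];
  exists (p ^+ 2 * s), (fun i => p ^+ 2 *: S i); split.
  + exact: sum_of_squares_sqrM.
  + move=> i; have [k [P ->]] := hS i; exists k, (p *: P).
    have -> : (p *: P)^T = p *: P^T by apply/matrixP => a b; rewrite !mxE.
    by rewrite -scalemxAl -scalemxAr scalerA.
  + rewrite mulrDr rmorphM rmorphXn; congr (_ + _); rewrite mulr_sumr.
    apply: eq_bigr => i _.
    by rewrite map_mxZ -scalemxAl mxtraceZ rmorphXn.
Qed.

Lemma Qx_mxtrace i (S : 'M[A]_(q i)) :
  sos_mx S -> Qx G (\tr (map_mx (of_x r) S *m G i)).
Proof.
(* Matrix sizes vary with the index, so the family supported at [i] is a dependent update of the
   zero family. *)
move=> hS; exists 0, (dfwith (fun j => 0 : 'M[A]_(q j)) S); split.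
- exact: sum_of_squares0.
- move=> j; case: dfwithP => // k _; exists 0, 0; by rewrite mulmx0.
- rewrite rmorph0 add0r (bigD1 i)//= dfwith_in big1 ?addr0// => j ji.
  by rewrite dfwith_out 1?eq_sym// map_mx0 mul0mx mxtrace0.
Qed.

End Cone.

(** By cyclicity of the trace. Nonnegativity of these scalars for all [v] is the semidefiniteness
    required in [in_K]. *)
Lemma meval_mxtrace_rank_one (x : 'I_n -> R) (lam : 'I_r -> R) (q : nat)
    (v : 'cV[R]_q) (H : 'M[E]_q) :
  (\tr (map_mx (of_x r) (map_mx (@mpolyC n R) (v *m v^T)) *m H)).@[point x lam] =
  (v^T *m map_mx (meval (point x lam)) H *m v) 0 0.
Proof.
rewrite -trace_map_mx map_mxM.
have -> : map_mx (meval (point x lam))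
    (map_mx (of_x r) (map_mx (@mpolyC n R) (v *m v^T))) = v *m v^T.
  by apply/matrixP => i j; rewrite !mxE meval_of_x mevalC.
by rewrite mxtrace_mulC mulmxA mxtrace_mulC mulmxA trace_mx11.
Qed.

Lemma sos_mx_rank_one (q : nat) (v : 'cV[R]_q) :
  sos_mx (map_mx (@mpolyC n R) (v *m v^T)).
Proof.
by exists 1%N, (map_mx (@mpolyC n R) v^T); rewrite map_mxM map_trmx trmxK.
Qed.

Lemma scale1_of_x (N : R) : N *: (1 : E) = of_x r N%:MP.
Proof. by rewrite of_xC -mul_mpolyC mulr1. Qed.

Lemma archimedean_of_order_unit (Q : E -> Prop) :
  order_unit V Q 1 -> archimedean_on (@mpolyC n R) (@of_x R n r) V Q.
Proof. by move=> [_ h] v /h[N]; rewrite scale1_of_x => hN; exists N. Qed.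

Lemma square_bounded_ball (Q : E -> Prop) (b : R) :
  quadratic_module (@of_x R n r) Q ->
  0 < b -> Q (of_x r (b%:MP - \sum_(j < n) 'X_j ^+ 2)) ->
  forall p, square_bounded (@mpolyC n R) (@of_x R n r) Q p.
Proof.
move=> qmQ b0 hb; elim/mpoly_subring_ind => [c|j|p s|p s].
- exact: (square_bounded_cst (@mpolyC n R) qmQ).
- exists b; split => //.
  (* Adding back the squares of the other variables isolates ['X_j]. *)
  have -> : of_x r b%:MP - of_x r 'X_j ^+ 2 =
      of_x r (b%:MP - \sum_(j < n) 'X_j ^+ 2)
      + of_x r (\sum_(k < n | k != j) 'X_k ^+ 2) * 1.
    by rewrite (bigD1 j)//=; ring.
  apply: (qmD qmQ hb); apply: (qm_sosM qmQ); last exact: (qm1 qmQ).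
  apply: big_ind => [||k _]; [exact: sum_of_squares0|exact: sum_of_squaresD|].
  by exists [:: 'X_k]; rewrite big_seq1.
- exact: square_boundedD.
- exact: square_boundedM.
Qed.

End LinearPencils.

(** * Representation of positive polynomials and the order unit criterion *)

Theorem theorem6p1 (R : realType) (n r m : nat) (q : 'I_m -> nat)
    (G0 : forall i : 'I_m, 'M[{mpoly R[n]}]_(q i))
    (G1 : forall i : 'I_m, 'I_r -> 'M[{mpoly R[n]}]_(q i))
    (G : forall i : 'I_m, 'M[{mpoly R[n + r]}]_(q i))
    (G_affine : forall i : 'I_m, G i = pencil (G0 i) (G1 i))
    (G_sym : forall i : 'I_m, (G i)^T = G i) :
  (order_unit (@affine_in_lambda R n r) (Qx G) 1 ->
   forall f : {mpoly R[n + r]},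
     affine_in_lambda f ->
     (forall (x : 'I_n -> R) (lam : 'I_r -> R),
        in_K G x lam -> 0 < f.@[point x lam]) ->
     exists (s0 : {mpoly R[n]}) (S : forall i : 'I_m, 'M[{mpoly R[n]}]_(q i)),
       [/\ sos s0, forall i : 'I_m, sos_mx (S i)
         & f = of_x r s0 + \sum_(i < m) \tr (map_mx (of_x r) (S i) *m G i)])
  /\
  (order_unit (@affine_in_lambda R n r) (Qx G) 1 <->
   exists (b : R) (C : 'I_r -> R),
     [/\ 0 < b, forall k : 'I_r, 0 < C k,
         Qx G (of_x r (b%:MP - \sum_(j < n) 'X_j ^+ 2))
       & forall k : 'I_r, Qx G ((C k)%:MP + lambda n k)
                          /\ Qx G ((C k)%:MP - lambda n k)]).
Proof.
have qmQ := quadratic_module_Qx G.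
split; last split.
- move=> ou f Vf fpos; apply: contrapT => nQf.
  have archQ := archimedean_of_order_unit ou.
  have [M [qmM QM Mf neM re]] := separating_module (@affine1 R n r)
    (@affineD R n r) (@affineM R n r) qmQ archQ Vf nQf.
  have archM : archimedean_on (@mpolyC n R) (@of_x R n r)
      (@affine_in_lambda R n r) M.
    by move=> v /archQ[N [N0 h1 h2]]; exists N; split => //; apply: QM.
  have /choice[x hx] j := re _ (affine_of_x r ('X_j : {mpoly R[n]})).
  have /choice[lam hl] k := re _ (affine_lambda R n k).
  have ev v := infinitesimal_meval qmM archM hx hl (v := v).
  have pos v : affine_in_lambda v -> M v -> 0 <= v.@[point x lam].
    by move=> Vv; apply: (infinitesimal_cst qmM neM (ev v Vv)).
  have Kx : in_K G x lam.
    move=> i; split => [|v]; first by rewrite map_trmx G_sym.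
    rewrite -meval_mxtrace_rank_one; apply: pos.
      by rewrite G_affine; apply: affine_mxtrace_pencil.
    by apply/QM/Qx_mxtrace/sos_mx_rank_one.
  have := fpos _ _ Kx; apply/negP; rewrite -leNgt -oppr_ge0 -mevalN.
  apply: pos => //; rewrite -mulN1r -(rmorph1 (of_x r)) -rmorphN.
  exact: affineM.
- move=> /archimedean_of_order_unit arch.
  have [b [b0 _ hb]] := arch _ (affine_of_x r (\sum_(j < n) 'X_j ^+ 2)).
  have /choice[C hC] k := arch _ (affine_lambda R n k).
  exists b, C; split => //; first by move=> k; case: (hC k).
    by rewrite rmorphB.
  by move=> k; have [_ h1 h2] := hC k; rewrite -of_xC.
- move=> [b [C [b0 C0 hb hC]]]; split; first exact: (qm1 qmQ).
  move=> v [p0 [p ->]].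
  have bdA := square_bounded_ball qmQ b0 hb.
  suff [N hN] : bounded (@mpolyC n R) (@of_x R n r) (Qx G)
      (of_x r p0 + \sum_(k < r) lambda n k * of_x r (p k)).
    by exists N; rewrite scale1_of_x.
  have bD := @boundedD _ _ _ (@mpolyC n R) _ _ qmQ.
  have bM s w := @boundedM _ _ _ (@mpolyC n R) _ _ qmQ s w bdA.
  have b1 := bounded1 (@mpolyC n R) qmQ.
  (* As a module over the polynomials in [x], V_r is generated by [1] and the [lambda n k], all of
     which are bounded. *)
  apply: (bD); first by rewrite -[of_x r p0]mulr1; apply: bM.
  apply: big_ind => [||k _].
  + by rewrite -[0](mul0r 1) -(rmorph0 (of_x r)); apply: bM.
  + exact: (bD).
  + rewrite mulrC; apply: bM; exists (C k); rewrite /= of_xC.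
    by have [] := hC k.
Qed.
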